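(* Assume the loss $\ell(\mathbf{y},\cdot)$ is $L$-Lipschitz for all $\mathbf{y}$ and takes values in $[0,B]$, and the $T$ source tasks are independently drawn from a task distribution $\mathcal{D}_{\text{task}}$. Let $\widehat{\mathrm{Alg}}$ be the empirical minimizer of the ICL-ERM objective over the source tasks and $\mathcal{T}\sim\mathcal{D}_{\text{task}}$. Then with probability at least $1-2\delta$, the expected excess transfer learning risk obeys \[ \mathbb{E}_{\mathcal{T}}[R_\mathcal{T}(\widehat{\mathrm{Alg}})]\leq\min_{\varepsilon\geq0}\left\{4L\varepsilon+B\sqrt{\frac{2\log(\mathcal{N}(\mathcal{A},\rho,\varepsilon)/\delta)}{T}}\right\}. \]
   Context: Algorithms $\mathrm{Alg}\in\mathcal{A}$ map a sequence $\mathcal{S}^{(i)}=(\mathbf{x}_j,\mathbf{y}_j)_{j=1}^{i}$ to predictors $f^{\mathrm{Alg}}_{\mathcal{S}^{(i)}}$. Source task $t$ has sequence $\mathcal{S}_t=(\mathbf{x}_{ti},\mathbf{y}_{ti})_{i=1}^n$ i.i.d. from $\mathcal{D}_t$; $\widehat{\mathcal{L}}_t(\mathrm{Alg})=\frac1n\sum_{i}\ell(\mathbf{y}_{ti},f^{\mathrm{Alg}}_{\mathcal{S}_t^{(i-1)}}(\mathbf{x}_{ti}))$ and ICL-ERM is $\widehat{\mathrm{Alg}}=\arg\min_{\mathrm{Alg}}\frac1T\sum_t\widehat{\mathcal{L}}_t(\mathrm{Alg})$. For a target task $\mathcal{T}$ with sequence $\mathcal{S}_\mathcal{T}=(\mathbf{x}_i,\mathbf{y}_i)_{i=1}^n\sim\mathcal{D}_\mathcal{T}$,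 $\widehat{\mathcal{L}}_\mathcal{T}(\mathrm{Alg})=\frac1n\sum_i\ell(\mathbf{y}_i,f^{\mathrm{Alg}}_{\mathcal{S}^{(i-1)}_\mathcal{T}}(\mathbf{x}_i))$, $\mathcal{L}_\mathcal{T}=\mathbb{E}_{\mathcal{S}_\mathcal{T}}[\widehat{\mathcal{L}}_\mathcal{T}]$, and $\mathbb{E}_{\mathcal{T}}[R_\mathcal{T}(\widehat{\mathrm{Alg}})]:=\mathbb{E}_{\mathcal{T}}[\mathcal{L}_\mathcal{T}(\widehat{\mathrm{Alg}})]-\min_{\mathrm{Alg}\in\mathcal{A}}\mathbb{E}_{\mathcal{T}}[\mathcal{L}_\mathcal{T}(\mathrm{Alg})]$. $\rho(\mathrm{Alg},\mathrm{Alg}')=\sup_{\mathcal{S}}\frac1n\sum_{i=1}^n\|f^{\mathrm{Alg}}_{\mathcal{S}^{(i-1)}}(\mathbf{x}_i)-f^{\mathrm{Alg}'}_{\mathcal{S}^{(i-1)}}(\mathbf{x}_i)\|_2$ over worst-case admissible sequences, and $\mathcal{N}(\mathcal{A},\rho,\varepsilon)$ is the $\varepsilon$-covering number. *)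

(* Defs.v *)
From HB Require Import structures.
From mathcomp Require Import all_boot all_order all_algebra.
From mathcomp Require Import all_classical all_reals all_analysis kernel.
Set Implicit Arguments. Unset Strict Implicit. Unset Printing Implicit Defensive.
Import Order.TTheory GRing.Theory Num.Theory.
Import numFieldNormedType.Exports.
Local Open Scope classical_set_scope.
Local Open Scope ring_scope.

Section ICL.
Variables (R : realType) (X Y : Type) (k n : nat).

Definition algo := seq (X * Y) -> X -> 'rV[R]_k.

Definition l2norm (v : 'rV[R]_k) : R := Num.sqrt (\sum_(j < k) v ord0 j ^+ 2).

(* A length-n sequence S = (x_i, y_i)_{i<n}; prefix S i = S^{(i)}
   consists of the first i examples (0-based index i corresponds to the
   paper's S^{(i-1)} for the 1-based i+1-th example). *)
Definition prefix (S : 'I_n -> X * Y) (i : 'I_n) : seq (X * Y) :=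
  map S (take i (enum 'I_n)).

Definition emp_loss (loss : Y -> 'rV[R]_k -> R) (a : algo)
    (S : 'I_n -> X * Y) : R :=
  n%:R^-1 * \sum_(i < n) loss (S i).2 (a (prefix S i) (S i).1).

Definition alg_dist (a b : algo) : \bar R :=
  ereal_sup (range (fun S : 'I_n -> X * Y =>
    (n%:R^-1 * \sum_(i < n)
       l2norm (a (prefix S i) (S i).1 - b (prefix S i) (S i).1))%:E)).

Definition is_cover (A : set algo) (eps : R) (m : nat) : Prop :=
  exists C : 'I_m -> algo, (forall j, A (C j)) /\
    (forall a, A a -> exists j, (alg_dist a (C j) <= eps%:E)%E).

(* Covering number N(A, rho, eps) (= +oo if no finite cover exists). *)
Definition cover_num (A : set algo) (eps : R) : \bar R :=
  ereal_inf [set (m%:R)%:E | m in is_cover A eps].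

End ICL.

(* Measurability of a real function of a length-n sequence, w.r.t. the
   product sigma-algebra on (X*Y)^n generated by the coordinate maps. *)
Definition seq_measurable {R : realType} {d : measure_display}
    {Z : measurableType d} (n : nat) (g : ('I_n -> Z) -> R) : Prop :=
  forall B : set R, measurable B ->
    <<s \bigcup_(i in [set: 'I_n])
          preimage_set_system setT (fun s : 'I_n -> Z => s i) measurable >>
      (g @^-1` B).

Arguments l2norm {R k} v.
Arguments prefix {X Y n} S i.
Arguments emp_loss {R X Y k} n loss a S.
Arguments alg_dist {R X Y k} n a b.
Arguments is_cover {R X Y k} n A eps m.
Arguments cover_num {R X Y k} n A eps.
Arguments seq_measurable {R d Z n} g.

(* Main.v *)
(* Fix an eps-cover of the class with N elements. For a fixed algorithm the
   source losses of the T tasks are independent, [0, B]-valued and have the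
   transfer risk as their mean, so Hoeffding's inequality and a union bound
   give, with probability at least 1 - 2 delta, a deviation of at most
   s = (B / 2) sqrt (2 ln (N / delta) / T) simultaneously for all centers of
   the cover. Passing from an algorithm to its center costs L eps for the
   empirical and for the expected loss, so comparing the empirical minimizer
   with an arbitrary competitor costs 4 L eps + 2 s in total. Using the cover
   also for the competitor avoids any attainment of the infimum.

   Independence is only given on rectangles. For independent S_t the identity
   E [prod_t h (S_t)] = prod_t E [h (S_t)] is obtained by replacing, one t at
   a time, indicators of rectangles by h: both sides are, as functions of the
   t-th rectangle, finite measures that agree on a pi-system. *)
Require Import Defs.
From HB Require Import structures.
From mathcomp Require Import all_boot all_order all_algebra.
From mathcomp Require Import all_classical all_reals all_analysis kernel.
From mathcomp Require Import measurable_realfun ring lra.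
Set Implicit Arguments.
Unset Strict Implicit.
Import Order.TTheory GRing.Theory Num.Theory.
Import numFieldNormedType.Exports.
Local Open Scope classical_set_scope.
Local Open Scope ring_scope.

(** * Moment generating functions of bounded variables *)

Lemma ge0_is_derive_le (R : realType) (f df : R -> R) (a b : R) : a <= b ->
  (forall x : R, is_derive x 1 f (df x)) ->
  (forall x, a <= x -> 0 <= df x) -> f a <= f b.
Proof.
move=> ab dfP df0.
have cf : {within `[a, b], continuous f}.
  apply: derivable_within_continuous => x _.
  by have [] := dfP x.
have [c] := MVT_segment ab (fun x _ => dfP x) cf.
rewrite in_itv/= => /andP[ac _] E.
by rewrite -subr_ge0 E mulr_ge0 ?subr_ge0 ?df0.
Qed.

(** Hoeffding's lemma for a Bernoulli variable. The gap [p * x + x ^+ 2 / 8 - ln (D x)] and its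
    derivative [g] both vanish at 0, and [g] has nonnegative derivative, so the gap is nonnegative
    for [0 <= x]. *)
Lemma bernoulli_mgf_le (R : realType) (p h : R) : 0 <= p <= 1 -> 0 <= h ->
  1 - p + p * expR h <= expR (p * h + h ^+ 2 / 8).
Proof.
move=> /andP[p0 p1] h0.
pose D (x : R) : R := 1 - p + p * expR x.
have D0 x : 0 < D x.
  rewrite /D; have e0 := expR_gt0 x.
  have [->|pn0] := eqVneq p 0; first by rewrite subr0 mul0r addr0.
  have : 0 < p * expR x by rewrite mulr_gt0// lt_neqAle eq_sym pn0.
  by lra.
pose g (x : R) : R := p + x / 4 - p * expR x / D x.
have dE (x : R) : is_derive x 1 (fun x => p * expR x) (p * expR x).
  by have H := is_deriveZ p (is_derive_expR x).
have dD (x : R) : is_derive x 1 D (p * expR x).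
  have H := is_deriveD (is_derive_cst (1 - p) x 1) (dE x).
  apply: (is_derive_eq H).
  by rewrite add0r.
have dlnD (x : R) : is_derive x 1 (fun x => ln (D x)) (p * expR x / D x).
  have := is_derive1_comp (is_derive1_ln (D0 x)) (dD x).
  by rewrite mulrC.
have df (x : R) : is_derive x 1 (fun x => p * x + x ^+ 2 / 8 - ln (D x)) (g x).
  have H := is_deriveB (is_deriveD (is_deriveZ p (is_derive_id x 1))
    (is_deriveM (is_deriveX 2 (is_derive_id x 1))
      (is_derive_cst (8^-1 : R) x 1))) (dlnD x).
  apply: (is_derive_eq H).
  rewrite /g /GRing.scale/= /cst /=; field.
  by rewrite gt_eqF.
have dg (x : R) : is_derive x 1 g (4^-1 - p * expR x * (1 - p) / D x ^+ 2).
  have DN0 : D x != 0 by rewrite gt_eqF.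
  have H := is_deriveB (is_deriveD (is_derive_cst p x 1)
    (is_deriveM (is_derive_id x 1) (is_derive_cst (4^-1 : R) x 1)))
    (is_deriveM (dE x) (is_deriveV DN0 (dD x))).
  apply: (is_derive_eq H).
  rewrite /GRing.scale/= /cst /= /D; field.
  by move: DN0; rewrite /D.
have g_ge0 x : 0 <= x -> 0 <= g x.
  move=> x0; have : g 0 <= g x.
    suff dg0 y : 0 <= 4^-1 - p * expR y * (1 - p) / D y ^+ 2.
      exact: (ge0_is_derive_le x0 dg (fun y _ => dg0 y)).
    (* With [q = p * expR y / D y], a number in [0, 1], the left side is
       [1/4 - q (1 - q) = (1 - 2 q)^2 / 4]. *)
    have -> : 4^-1 - p * expR y * (1 - p) / D y ^+ 2 =
        (1 - p - p * expR y) ^+ 2 / (4 * D y ^+ 2).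
      have := D0 y; rewrite /D => Dy; field.
      by rewrite gt_eqF.
    by rewrite divr_ge0 ?sqr_ge0// mulr_ge0 ?sqr_ge0.
  by apply: le_trans; rewrite /g /D expR0 mulr1 subrK mul0r addr0 divr1 subrr.
have : 0 <= p * h + h ^+ 2 / 8 - ln (D h).
  have := ge0_is_derive_le h0 df g_ge0.
  by apply: le_trans;
    rewrite /D expR0 mulr1 subrK ln1 mulr0 expr2 mulr0 mul0r addr0 subr0.
by rewrite subr_ge0 -ler_expR lnK ?posrE.
Qed.

(** * Expectation of a product of independent variables *)

Section weighted_measure.
Local Open Scope ereal_scope.
Context d (T : measurableType d) (R : realType).
Variables (mu : {finite_measure set T -> \bar R}) (W : T -> R).
Hypothesis intW : mu.-integrable setT (EFin \o W).
Hypothesis W0 : forall x, (0 <= W x)%R.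

(* The two proofs are arguments so that the measure instances below can be
   attached to this set function. *)
Definition weighted_measure_of (intW : mu.-integrable setT (EFin \o W))
  (W0 : forall x, (0 <= W x)%R) (A : set T) : \bar R :=
  \int[mu]_(x in A) (W x)%:E.
Local Notation nu := (weighted_measure_of intW W0).

Let mW : measurable_fun setT (fun x => (W x)%:E).
Proof. exact: measurable_int intW. Qed.

Let nu0 : nu set0 = 0.
Proof. exact: integral_set0. Qed.

Let nu_ge0 A : 0 <= nu A.
Proof. by apply: integral_ge0 => x _; rewrite lee_fin. Qed.

Let nu_sigma_additive : semi_sigma_additive nu.
Proof.
move=> F mF tF mUF; rewrite /weighted_measure_of ge0_integral_bigcup//.
- by apply: is_cvg_nneseries => n _ _; apply: nu_ge0.
- by apply: measurable_funS mW.
- by move=> x _; rewrite lee_fin.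
Qed.

HB.instance Definition _ :=
  isMeasure.Build _ _ _ nu nu0 nu_ge0 nu_sigma_additive.

Let nu_fin : fin_num_fun nu.
Proof.
move=> A mA; rewrite /weighted_measure_of integrable_fin_num//.
exact: integrableS intW.
Qed.

HB.instance Definition _ := Measure_isFinite.Build _ _ _ nu nu_fin.

Definition weighted_measure : {finite_measure set T -> \bar R} := nu.

Lemma weighted_measureE A :
  weighted_measure A = \int[mu]_(x in A) (W x)%:E.
Proof. by []. Qed.

(** Change of variables holds for the Radon-Nikodym derivative of the weighted measure. That
    derivative equals [W] almost everywhere, since both have the same integral over every measurable
    set. *)
Lemma integral_weighted_measure (f : T -> \bar R) :
  measurable_fun setT f -> (forall x, 0 <= f x) ->
  \int[weighted_measure]_x f x = \int[mu]_x (f x * (W x)%:E).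
Proof.
move=> mf f0.
have nu_mu : weighted_measure `<< mu.
  apply/null_content_dominatesP => A mA muA; rewrite weighted_measureE.
  by rewrite null_set_integral//; exact: measurable_funTS.
rewrite -(Radon_Nikodym_SigmaFinite.change_of_variables nu_mu)//.
apply: ge0_ae_eq_integral => //.
- apply: emeasurable_funM => //.
  exact: measurable_int (Radon_Nikodym_SigmaFinite.f_integrable nu_mu).
- exact: emeasurable_funM.
- by move=> x _; rewrite mule_ge0// Radon_Nikodym_SigmaFinite.f_ge0.
- by move=> x _; rewrite mule_ge0// lee_fin.
apply: ae_eqe_mul2l.
apply: integral_ae_eq => //.
  exact: Radon_Nikodym_SigmaFinite.f_integrable.
by move=> E _ mE; rewrite -Radon_Nikodym_SigmaFinite.f_integral.
Qed.

End weighted_measure.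

Arguments weighted_measure {d T R mu W} intW W0.

Lemma bounded_integrable d (U : measurableType d) (R : realType)
    (mu : probability U R) (f : U -> R) (M : R) : measurable_fun setT f ->
  (forall x, 0 <= f x <= M) -> mu.-integrable setT (EFin \o f).
Proof.
move=> mf fM; apply: measurable_bounded_integrable => //.
  exact: le_lt_trans (probability_le1 mu measurableT) (ltry _).
exists M; split; first exact: num_real.
move=> x Mx y _ /=; have /andP[f0 fy] := fM y.
by rewrite ger0_norm// (le_trans fy)// ltW.
Qed.

Section expectation_prod.
Local Open Scope ereal_scope.
Context d (Omega : measurableType d) (R : realType) (P : probability Omega R).
Context d' (V : measurableType d') (Q : probability V R) (T : nat).
Variables (G : set (set V)) (S : 'I_T -> Omega -> V).
Hypotheses (mG : @measurable _ V = <<s G >>) (setIG : setI_closed G).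
Hypothesis GT : G setT.
Hypothesis mS : forall t, measurable_fun setT (S t).
Hypothesis indep : forall C : 'I_T -> set V, (forall t, G (C t)) ->
  P (\bigcap_(t in [set: 'I_T]) (S t @^-1` C t)) = \prod_(t < T) Q (C t).

Lemma measurable_generator A : G A -> measurable A.
Proof. by move=> GA; rewrite mG; exact: sub_sigma_algebra. Qed.

(** The exchange of one indicator for [h]: the left side integrates [h] against the image under
    [S t] of the measure with density [W], the right side against [c] times [Q]. *)
Lemma weighted_law_ext (W : Omega -> R) (c M : R) (t : 'I_T) (h : V -> R) :
  measurable_fun setT W -> (forall w, 0 <= W w <= M)%R -> (0 <= c)%R ->
  measurable_fun setT h -> (forall v, 0 <= h v)%R ->
  (forall C, G C -> \int[P]_w (\1_C (S t w) * W w)%:E = c%:E * Q C) ->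
  \int[P]_w (h (S t w) * W w)%:E = c%:E * \int[Q]_v (h v)%:E.
Proof.
move=> mW WM c0 mh h0 WG.
have intW := bounded_integrable P mW WM.
have W0 w : (0 <= W w)%R by have /andP[] := WM w.
have mhe : measurable_fun setT (EFin \o h) by exact/measurable_EFinP.
pose nu := weighted_measure intW W0.
pose law : {measure set V -> \bar R} := pushforward nu (S t).
pose m1 := law (mS t).
pose m2 : {measure set V -> \bar R} := mscale (NngNum c0) Q.
have m12 A : measurable A -> m1 A = m2 A.
  apply: (measure_unique G (fun=> setT)) => //.
  - by rewrite bigcup_const.
  - move=> C GC; have mC := measurable_generator GC.
    rewrite /m1 /law /m2 /= /mscale/= /pushforward -WG// weighted_measureE.
    have mSC : measurable (S t @^-1` C).
      by rewrite -[X in measurable X]setTI; exact: mS.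
    rewrite integral_mkcond; apply: eq_integral => w _.
    rewrite patchE indicE (_ : (w \in S t @^-1` C) = (S t w \in C))//.
    by case: ifP => _; rewrite ?mul1r ?mul0r.
  - move=> _; rewrite /m1 /law /= /pushforward preimage_setT.
    by rewrite -ge0_fin_numE ?fin_num_measure.
transitivity (\int[nu]_w (h (S t w))%:E).
  rewrite integral_weighted_measure//; last by move=> w; rewrite lee_fin.
  by apply/measurable_EFinP; exact: measurableT_comp.
transitivity (\int[m1]_v (h v)%:E).
  by rewrite /m1 /law ge0_integral_pushforward//= => v _; rewrite lee_fin.
rewrite (eq_measure_integral m2); last by move=> A mA _; exact: m12.
by rewrite /m2 ge0_integral_mscale// => v _; rewrite lee_fin.
Qed.

Lemma expectation_prod (h : V -> R) (M : R) :
  measurable_fun setT h -> (forall v, 0 <= h v <= M)%R ->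
  \int[P]_w (\prod_(t < T) h (S t w))%:E = \prod_(t < T) \int[Q]_v (h v)%:E.
Proof.
(* A common bound for [h] and for the indicators. *)
move=> mh hM; pose N := Num.max 1%R M.
(* [u m C] uses [h] for the first [m] variables, indicators for the others. *)
pose u m (C : 'I_T -> set V) (t : 'I_T) v : R :=
  if (t < m)%N then h v else \1_(C t) v.
suff claim : forall m, (m <= T)%N -> forall C, (forall t, G (C t)) ->
    \int[P]_w (\prod_(t < T) u m C t (S t w))%:E =
    \prod_(t < T) \int[Q]_v (u m C t v)%:E.
  have := claim T (leqnn T) (fun=> setT) (fun=> GT).
  have uE t : u T (fun=> setT) t = h by apply/funext => v; rewrite /u ltn_ord.
  under eq_integral do under eq_bigr do rewrite uE.
  by under [RHS]eq_bigr do rewrite uE.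
have u01 k C t v : (0 <= u k C t v <= N)%R.
  rewrite /u; case: ifP => _.
    by have /andP[-> hv] := hM v; rewrite le_max hv orbT.
  by rewrite indicE ler0n le_max lern1 leq_b1.
have mu_ k C t : G (C t) -> measurable_fun setT (u k C t).
  move=> GC; rewrite /u; case: (t < k)%N => //.
  by apply: measurable_indic; exact: measurable_generator.
have integral_u k C t : G (C t) -> \int[Q]_v (u k C t v)%:E \is a fin_num /\
    0 <= \int[Q]_v (u k C t v)%:E.
  move=> GC; split.
    rewrite integrable_fin_num//.
    exact: bounded_integrable (mu_ _ _ _ GC) (u01 k C t).
  apply: integral_ge0 => v _.
  by rewrite lee_fin; have /andP[] := u01 k C t v.
elim=> [_ C GC|m IH mT C GC].
  (* With no [h] yet, the product is the indicator of an intersection of preimages, so this case is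
     [indep]. *)
  transitivity (\prod_(t < T) Q (C t)); last first.
    apply: eq_bigr => t _; rewrite -[RHS]/(\int[Q]_v (\1_(C t) v)%:E).
    by rewrite integral_indic ?setIT//; exact: measurable_generator.
  rewrite -indep//.
  have mI : measurable (\bigcap_(t in [set: 'I_T]) (S t @^-1` C t)).
    apply: fin_bigcap_measurable => // t _.
    rewrite -[X in measurable X]setTI; apply: mS => //.
    exact: measurable_generator.
  rewrite -[X in _ = P X]setIT -integral_indic//.
  apply: eq_integral => w _; congr (_%:E); rewrite /u /= indicE.
  have [wC|wC] := boolP (w \in _).
    rewrite big1// => t _; rewrite indicE.
    by move: wC; rewrite inE => /(_ t I) Ct; rewrite mem_set.
  have [t Ct] : exists t, ~ C t (S t w).
    apply/existsNP => wC'; move/negP: wC; apply; rewrite inE => t _; exact: wC'.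
  by rewrite (bigD1 t)//= indicE memNset// mul0r.
pose t0 := Ordinal mT.
have ut0 : u m.+1 C t0 = h by apply/funext => v; rewrite /u /= ltnS leqnn.
have une t C' : t != t0 ->
    u m.+1 C t = u m (fun t => if t == t0 then C' else C t) t.
  move=> tt0; rewrite /u (negbTE tt0) ltnS leq_eqVlt.
  suff -> : (t == m :> nat) = false by [].
  by apply/negbTE; apply: contra tt0 => /eqP tm; apply/eqP/val_inj.
have GC' C' : G C' -> forall t, G (if t == t0 then C' else C t).
  by move=> ? t; case: ifP.
(* Only the factor at [t0] changes from [m] to [m.+1]. The remaining factors form the weight [W],
   and the product of their integrals is the constant [c]. *)
pose W w := (\prod_(t < T | t != t0) u m.+1 C t (S t w))%R.
pose c := \prod_(t < T | t != t0) \int[Q]_v (u m.+1 C t v)%:E.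
have cfin : c \is a fin_num.
  by apply: prode_fin_num => t _; have [] := integral_u m.+1 C t (GC t).
rewrite (bigD1 t0)//= ut0 -/c muleC -(fineK cfin).
under eq_integral do rewrite (bigD1 t0)//= ut0.
apply: (@weighted_law_ext W _ (\prod_(t < T | t != t0) N)%R) => //.
- rewrite [W](_ : _ = fun w =>
    \prod_(t <- [seq t <- index_enum 'I_T | t != t0]) u m.+1 C t (S t w))%R;
    last first.
    by apply/funext => w; rewrite big_filter.
  apply: measurable_prod => t _; apply: measurableT_comp (mS t); exact: mu_.
- move=> w; apply/andP; split.
    by apply: prodr_ge0 => t _; have /andP[] := u01 m.+1 C t (S t w).
  by apply: ler_prod => t _.
- rewrite fine_ge0// prode_ge0// => t _.
  by have [] := integral_u m.+1 C t (GC t).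
- by move=> v; have /andP[] := hM v.
move=> C' GC1; rewrite (fineK cfin).
have := IH (ltnW mT) _ (GC' _ GC1).
rewrite (bigD1 t0)//= muleC.
have -> : u m (fun t => if t == t0 then C' else C t) t0 = \1_C'.
  by apply/funext => v; rewrite /u ltnn eqxx.
rewrite integral_indic ?setIT//; last exact: measurable_generator.
rewrite (eq_bigr (fun t => \int[Q]_v (u m.+1 C t v)%:E)); last first.
  by move=> t tt0; rewrite -une.
rewrite -/c => <-; apply: eq_integral => w _.
rewrite (bigD1 t0)//=; congr (_ * _)%:E.
  by rewrite /u ltnn eqxx.
by apply: eq_bigr => t tt0; rewrite -une.
Qed.

End expectation_prod.

(** * Hoeffding's inequality *)

(** Convexity of the exponential: [l * x] is the convex combination of [l * B] and 0 with weight
    [x / B] on the former. *)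
Lemma expR_le_chord (R : realType) (B l x : R) : 0 < B -> 0 <= x <= B ->
  expR (l * x) <= 1 + x / B * (expR (l * B) - 1).
Proof.
move=> B0 /andP[x0 xB].
have xB01 : 0 <= x / B <= 1.
  by rewrite divr_ge0 ?(ltW B0)//= ler_pdivrMr// mul1r.
have := @convex_expR R
  (Itv01 (proj1 (andP xB01)) (proj2 (andP xB01))) (l * B) 0.
rewrite !convRE/= /unstable.onem mulr0 addr0 expR0 mulr1.
rewrite (_ : x / B * (l * B) = l * x); last by field; rewrite gt_eqF.
by move/le_trans; apply; rewrite le_eqVlt; apply/orP; left; apply/eqP; ring.
Qed.

Section hoeffding_mgf.
Context d (V : measurableType d) (R : realType) (Q : probability V R).
Variables (g : V -> R) (B : R).
Hypotheses (mg : measurable_fun setT g) (gB : forall v, 0 <= g v <= B).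

Lemma mean_bounds :
  ((fine (\int[Q]_v (g v)%:E))%:E = \int[Q]_v (g v)%:E)%E /\
  0 <= fine (\int[Q]_v (g v)%:E) <= B.
Proof.
have fin := integrable_fin_num measurableT (bounded_integrable Q mg gB).
rewrite fineK//; split => //.
rewrite -!lee_fin fineK//; apply/andP; split.
  by apply: integral_ge0 => v _; rewrite lee_fin; have /andP[] := gB v.
apply: (@le_trans _ _ (\int[Q]_v (cst B%:E v))%E).
  apply: ge0_le_integral => //.
  - by move=> v _; rewrite lee_fin; have /andP[] := gB v.
  - exact/measurable_EFinP.
  - by move=> v _; rewrite lee_fin; have /andP[] := gB v.
by rewrite integral_cst// [X in (_ * X)%E](@probability_setT _ _ _ Q) mule1.
Qed.

(** Integrating the chord bound replaces [g] by a variable on the two points 0 and [B] with the same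
    mean. This is the Bernoulli case with [p = mu / B] and [h = l * B]. *)
Lemma hoeffding_mgf (l : R) : 0 < B -> 0 <= l ->
  (\int[Q]_v (expR (l * g v))%:E <=
   (expR (l * fine (\int[Q]_v (g v)%:E) + l ^+ 2 * B ^+ 2 / 8))%:E)%E.
Proof.
move=> B0 l0; have [] := mean_bounds; set mu := fine _ => muE mub.
have g0 v : 0 <= g v by have /andP[] := gB v.
pose c := (expR (l * B) - 1) / B.
have c0 : 0 <= c.
  by rewrite divr_ge0 ?(ltW B0)// subr_ge0 -expR0 ler_expR mulr_ge0// ltW.
have mge : measurable_fun setT (EFin \o g) by exact/measurable_EFinP.
apply: (@le_trans _ _ (\int[Q]_v (1%:E + c%:E * (g v)%:E))%E).
  apply: ge0_le_integral => //.
  - apply/measurable_EFinP; apply: measurableT_comp => //.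
    exact: measurable_funM.
  - apply: emeasurable_funD => //; exact: emeasurable_funM.
  - move=> v _; rewrite -EFinM -EFinD lee_fin.
    apply: le_trans (expR_le_chord _ B0 (gB v)) _.
    by rewrite /c mulrAC -mulrA mulrC.
rewrite ge0_integralD//; first last.
  - exact: emeasurable_funM.
  - by move=> v _; rewrite mule_ge0// lee_fin.
rewrite ge0_integralZl_EFin//; last by move=> v _; rewrite lee_fin.
rewrite integral_cst// [X in (_ * X)%E](@probability_setT _ _ _ Q) mule1 -muE.
rewrite -EFinM -EFinD lee_fin.
have := @bernoulli_mgf_le R (mu / B) (l * B).
have /andP[mu0 muB] := mub.
rewrite divr_ge0 ?(ltW B0)//= ler_pdivrMr// mul1r muB => /(_ erefl).
rewrite mulr_ge0 ?(ltW B0)// => /(_ erefl).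
rewrite (_ : mu / B * (l * B) + (l * B) ^+ 2 / 8 =
  l * mu + l ^+ 2 * B ^+ 2 / 8); last first.
  by field; rewrite gt_eqF.
apply: le_trans; rewrite le_eqVlt; apply/orP; left; apply/eqP; rewrite /c.
by field; rewrite gt_eqF.
Qed.

End hoeffding_mgf.

Section hoeffding.
Context d (Omega : measurableType d) (R : realType) (P : probability Omega R).
Context d' (V : measurableType d') (Q : probability V R) (T : nat).
Variables (G : set (set V)) (S : 'I_T -> Omega -> V).
Hypotheses (mG : @measurable _ V = <<s G >>) (setIG : setI_closed G).
Hypothesis GT : G setT.
Hypothesis mS : forall t, measurable_fun setT (S t).
Hypothesis indep : forall C : 'I_T -> set V, (forall t, G (C t)) ->
  P (\bigcap_(t in [set: 'I_T]) (S t @^-1` C t)) = (\prod_(t < T) Q (C t))%E.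
Hypothesis T0 : (0 < T)%N.

Let avg (g : V -> R) w := T%:R^-1 * \sum_(t < T) g (S t w).

Lemma measurable_avg (g : V -> R) : measurable_fun setT g ->
  measurable_fun setT (avg g).
Proof.
move=> mg; apply: measurable_funM => //; apply: measurable_sum => t.
exact: measurableT_comp (mS t).
Qed.

(** Chernoff's method: Markov's inequality for the exponential of [l] times the sum, which
    factorizes by independence, followed by the moment bound for each factor. *)
Lemma hoeffding_upper (g : V -> R) (B s : R) : measurable_fun setT g ->
  (forall v, 0 <= g v <= B) -> 0 < B -> 0 <= s ->
  (P [set w | (fine (\int[Q]_v (g v)%:E) + s < avg g w)%R] <=
    (expR (- (2 * T%:R * s ^+ 2 / B ^+ 2)))%:E)%E.
Proof.
move=> mg gB B0 s0; set mu := fine _; set A := [set w | _].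
have T0R : 0 < T%:R :> R by rewrite ltr0n.
have mA : measurable A.
  rewrite -[A]setTI; apply: measurable_fun_ltr => //; exact: measurable_avg.
(* the minimizer of [l ^+ 2 * B ^+ 2 / 8 - l * s] *)
pose l := 4 * s / B ^+ 2.
have l0 : 0 <= l by rewrite divr_ge0 ?mulr_ge0 ?exprn_ge0 ?(ltW B0).
pose h v := expR (l * g v).
have mh : measurable_fun setT h.
  by apply: measurableT_comp => //; exact: measurable_funM.
pose Z w := \prod_(t < T) h (S t w).
have ZE w : Z w = expR (l * T%:R * avg g w).
  rewrite /Z /h -expR_sum -mulr_sumr /avg; congr expR.
  by rewrite mulrA -(mulrA l) divff ?mulr1// gt_eqF.
have Z0 w : 0 <= Z w by rewrite ZE expR_ge0.
have mZ : measurable_fun setT (EFin \o Z).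
  apply/measurable_EFinP; rewrite (funext ZE).
  apply: measurableT_comp => //; apply: measurable_funM => //.
  exact: measurable_avg.
pose a := expR (l * T%:R * (mu + s)).
have aA : (a%:E * P A <= \int[P]_w (Z w)%:E)%E.
  rewrite -integral_cst//.
  apply: (@le_trans _ _ (\int[P]_(w in A) (Z w)%:E)%E).
    apply: ge0_le_integral => //.
    - by move=> w _; rewrite lee_fin expR_ge0.
    - exact: measurable_funTS.
    - move=> w; rewrite /A /= lee_fin ZE ler_expR => /ltW; apply: ler_wpM2l.
      by rewrite mulr_ge0// ltW.
  by apply: ge0_subset_integral => // w _; rewrite lee_fin.
have hB v : 0 <= h v <= expR (l * B).
  by rewrite expR_ge0/= ler_expR ler_wpM2l//; have /andP[] := gB v.
have := expectation_prod mG setIG GT mS indep mh hB.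
have [] := mean_bounds Q mh hB; set m := fine _ => hE hb; rewrite -hE => ZP.
move: aA; rewrite ZP -(big_morph EFin (@EFinM R) erefl).
rewrite prodr_const card_ord => aA.
have mle : m <= expR (l * mu + l ^+ 2 * B ^+ 2 / 8).
  by rewrite -lee_fin hE; exact: hoeffding_mgf.
have : (a%:E * P A <= (expR (l * mu + l ^+ 2 * B ^+ 2 / 8) ^+ T)%:E)%E.
  apply: le_trans aA _; rewrite lee_fin lerXn2r ?nnegrE ?expR_ge0//.
  by have /andP[] := hb.
rewrite -expRM_natl -(fineK (fin_num_measure P _ mA)) -EFinM !lee_fin.
rewrite -ler_pdivlMl ?expR_gt0// => /le_trans; apply.
rewrite /a -expRN -expRD ler_expR le_eqVlt; apply/orP; left; apply/eqP.
by rewrite /l; field; rewrite gt_eqF.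
Qed.

(** The lower tail of [g] is the upper tail of [B - g], which also takes values in [0, [B]]. *)
Lemma hoeffding_two_sided (g : V -> R) (B s : R) : measurable_fun setT g ->
  (forall v, 0 <= g v <= B) -> 0 < B -> 0 <= s ->
  (P [set w | (s < `|avg g w - fine (\int[Q]_v (g v)%:E)|)%R] <=
    (2 * expR (- (2 * T%:R * s ^+ 2 / B ^+ 2)))%:E)%E.
Proof.
move=> mg gB B0 s0; set mu := fine _; set e := expR _.
have mavg := measurable_avg mg.
have [muE _] := mean_bounds Q mg gB.
have mg' : measurable_fun setT (fun v => B - g v) by exact: measurable_funB.
have gB' v : 0 <= B - g v <= B.
  by have /andP[? ?] := gB v; rewrite subr_ge0 lerBlDr lerDl; apply/andP.
have mu' : fine (\int[Q]_v (B - g v)%:E) = B - mu.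
  have [mu'E _] := mean_bounds Q mg' gB'.
  apply/eqP; rewrite eq_sym subr_eq; apply/eqP/EFin_inj.
  rewrite EFinD mu'E muE -ge0_integralD//.
  - under eq_integral do rewrite -EFinD subrK.
    by rewrite integral_cst// [X in (_ * X)%E](@probability_setT _ _ _ Q) mule1.
  - by move=> v _; rewrite lee_fin; have /andP[] := gB' v.
  - exact/measurable_EFinP.
  - by move=> v _; rewrite lee_fin; have /andP[] := gB v.
  - exact/measurable_EFinP.
have avg' w : avg (fun v => B - g v) w = B - avg g w.
  rewrite /avg sumrB mulrBr sumr_const card_ord -[B *+ T]mulr_natl mulrA.
  by rewrite mulVf ?mul1r// pnatr_eq0 -lt0n.
have up := hoeffding_upper mg gB B0 s0.
have lo := hoeffding_upper mg' gB' B0 s0.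
have mset (f1 f2 : Omega -> R) :
    measurable_fun setT f1 -> measurable_fun setT f2 ->
    measurable [set w | f1 w < f2 w].
  by move=> m1 m2; rewrite -[X in measurable X]setTI; exact: measurable_fun_ltr.
apply: (@le_trans _ _ (P ([set w | mu + s < avg g w] `|`
    [set w | fine (\int[Q]_v (B - g v)%:E) + s < avg (fun v => B - g v) w])%R)).
  apply: le_measure; rewrite ?inE//.
  - apply: mset => //; apply: measurableT_comp => //; exact: measurable_funB.
  - apply: measurableU; apply: mset => //; exact: measurable_avg.
  - move=> w /=; rewrite mu' avg' ltr_normr => /orP[ltw|ltw]; [left|right]; lra.
apply: le_trans (measureU2 _ _ _) _.
- by apply: mset => //.
- by apply: mset => //; exact: measurable_avg.
by rewrite mulr_natl mulr2n EFinD leeD.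
Qed.

End hoeffding.

(** * The space of sequences *)

Section sequence_space.
Context d (Z : measurableType d) (n : nat).

Definition coordinate_system : set (set ('I_n -> Z)) :=
  \bigcup_(i in [set: 'I_n])
    preimage_set_system setT (fun s : 'I_n -> Z => s i) measurable.

(** Carries the sigma-algebra used in [seq_measurable], so that a whole sequence becomes a single
    random variable. *)
Definition seq_space := g_sigma_algebraType coordinate_system.

HB.instance Definition _ := Measurable.on seq_space.

(** The generating pi-system on which the independence of the source sequences is given. *)
Definition rectangles : set (set seq_space) :=
  [set A | exists2 C : 'I_n -> set Z, (forall i, measurable (C i)) &
    A = \bigcap_(i in [set: 'I_n]) [set s : seq_space | C i (s i)]].

Lemma rectangles_setT : rectangles setT.
Proof. by exists (fun=> setT) => //; apply/seteqP; split. Qed.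

Lemma rectangles_setI : setI_closed rectangles.
Proof.
move=> _ _ [C mC ->] [C' mC' ->].
exists (fun i => C i `&` C' i) => [i|]; first exact: measurableI.
by rewrite -bigcapI.
Qed.

Lemma measurable_rectangles :
  @measurable _ seq_space = <<s rectangles >>.
Proof.
apply/seteqP; split.
- apply: smallest_sub; first exact: smallest_sigma_algebra.
  move=> _ [i _ [C mC <-]]; apply: sub_sigma_algebra.
  exists (fun j => if j == i then C else setT) => [j|]; first by case: ifP.
  rewrite setTI; apply/seteqP; split => s /=.
    by move=> Cs j _ /=; case: ifPn => // /eqP ->.
  by move=> /(_ i I) /=; rewrite eqxx.
- apply: smallest_sub; first exact: sigma_algebra_measurable.
  move=> _ [C mC ->]; apply: fin_bigcap_measurable => // i _.
  apply: sub_sigma_algebra; exists i => //; exists (C i) => //.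
  by rewrite setTI.
Qed.

Lemma measurable_seq_space d' (O : measurableType d') (S : 'I_n -> O -> Z) :
  (forall i, measurable_fun setT (S i)) ->
  measurable_fun setT ((fun w => S ^~ w) : O -> seq_space).
Proof.
move=> mS; apply: (@measurability _ _ _ seq_space _ _ coordinate_system) => //.
move=> _ [_ [i _ [C mC <-]] <-]; rewrite !setTI.
by rewrite -[X in measurable X]setTI; exact: mS.
Qed.

Lemma seq_measurable_fun (R : realType) (g : ('I_n -> Z) -> R) :
  seq_measurable g -> measurable_fun [set: seq_space] g.
Proof. by move=> mg _ B mB; rewrite setTI; exact: mg. Qed.

End sequence_space.

(** * Covers and the excess risk *)

Lemma prob_bigsetU_le d (O : measurableType d) (R : realType)
    (P : probability O R) (m : nat) (F : 'I_m -> set O) (e : R) :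
  (forall j, measurable (F j)) -> (forall j, (P (F j) <= e%:E)%E) ->
  (P (\big[setU/set0]_(j < m) F j) <= (m%:R * e)%:E)%E.
Proof.
elim: m F => [|m IH] F mF Fe; first by rewrite big_ord0 measure0 mul0r.
rewrite big_ord_recr/=; apply: le_trans (measureU2 _ _ _) _ => //.
  exact: bigsetU_measurable.
rewrite -natr1 mulrDl mul1r EFinD; apply: leeD; last exact: Fe.
by apply: IH => j; [exact: mF|exact: Fe].
Qed.

(** An infimum below [+oo] is taken over a nonempty set of natural numbers, which has a least
    element. *)
Lemma cover_num_attained (R : realType) (X Y : Type) (k n : nat)
    (A : set (algo R X Y k)) (eps : R) : (cover_num n A eps < +oo)%E ->
  exists2 m, is_cover n A eps m & cover_num n A eps = m%:R%:E.
Proof.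
move=> Nfin.
have [m0 m0P] : exists m, is_cover n A eps m.
  apply: contrapT => H; move: Nfin; rewrite /cover_num.
  rewrite (_ : [set _ | _ in _] = set0) ?ereal_inf0 ?ltxx//.
  by apply/seteqP; split => // x [m mP _]; apply: H; exists m.
have exm : exists m, `[< is_cover n A eps m >] by exists m0; apply/asboolP.
case: (ex_minnP exm) => m /asboolP mP mmin; exists m => //.
apply/eqP; rewrite eq_le; apply/andP; split.
  by apply: ereal_inf_lbound; exists m.
apply: le_ereal_inf_tmp => _ [m' m'P <-].
by rewrite lee_fin ler_nat mmin//; apply/asboolP.
Qed.

Section lipschitz.
Variables (R : realType) (X Y : Type) (k n : nat) (L eps : R).
Variables (loss : Y -> 'rV[R]_k -> R).
Hypotheses (L0 : 0 <= L)
  (lossL : forall y u v, `|loss y u - loss y v| <= L * l2norm (u - v)).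

(** The Lipschitz bound is applied term by term; the resulting average of norms is one of the values
    under the supremum in [alg_dist]. *)
Lemma emp_loss_close (a c : algo R X Y k) (S : 'I_n -> X * Y) :
  (alg_dist n a c <= eps%:E)%E ->
  `|emp_loss n loss a S - emp_loss n loss c S| <= L * eps.
Proof.
move=> ac; have n0 : 0 <= n%:R^-1 :> R by rewrite invr_ge0.
rewrite /emp_loss -mulrBr normrM (ger0_norm n0) -sumrB.
pose r := n%:R^-1 * \sum_(i < n)
  l2norm (a (Defs.prefix S i) (S i).1 - c (Defs.prefix S i) (S i).1).
apply: (@le_trans _ _ (L * r)); last first.
  rewrite ler_wpM2l// -lee_fin; apply: le_trans ac.
  by apply: ereal_sup_ubound; exists S.
rewrite /r mulrCA ler_wpM2l// mulr_sumr.
by apply: le_trans (ler_norm_sum _ _ _) _; apply: ler_sum.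
Qed.

Lemma emp_loss_bounds (B : R) (a : algo R X Y k) (S : 'I_n -> X * Y) :
  0 <= B -> (forall y u, 0 <= loss y u <= B) -> 0 <= emp_loss n loss a S <= B.
Proof.
move=> B0 lossB; apply/andP; split.
  rewrite mulr_ge0// sumr_ge0// => i _.
  by have /andP[] := lossB (S i).2 (a (Defs.prefix S i) (S i).1).
(* For [n = 0] the inverse of 0 is 0 by convention, so the empirical loss is 0. *)
rewrite /emp_loss; have [n0|n0] := eqVneq n 0%N.
  by rewrite (_ : n%:R = 0) ?invr0 ?mul0r// n0.
rewrite ler_pdivrMl ?ltr0n ?lt0n//.
rewrite (_ : n%:R * B = \sum_(i < n) B); last first.
  by rewrite sumr_const card_ord mulr_natl.
apply: ler_sum => i _.
by have /andP[] := lossB (S i).2 (a (Defs.prefix S i) (S i).1).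
Qed.

End lipschitz.

Lemma mean_le_shift d (V : measurableType d) (R : realType)
    (Q : probability V R) (f g : V -> R) (B c : R) :
  measurable_fun setT f -> measurable_fun setT g ->
  (forall v, 0 <= f v <= B) -> (forall v, 0 <= g v <= B) -> 0 <= c ->
  (forall v, f v <= g v + c) ->
  fine (\int[Q]_v (f v)%:E) <= fine (\int[Q]_v (g v)%:E) + c.
Proof.
move=> mf mg fB gB c0 fg.
have f0 v : 0 <= f v by have /andP[] := fB v.
have g0 v : 0 <= g v by have /andP[] := gB v.
have [fE _] := mean_bounds Q mf fB; have [gE _] := mean_bounds Q mg gB.
rewrite -lee_fin EFinD fE gE.
rewrite (_ : c%:E = \int[Q]_v (cst c%:E v))%E; last first.
  by rewrite integral_cst// [X in (_ * X)%E](@probability_setT _ _ _ Q) mule1.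
rewrite -ge0_integralD//=.
- apply: ge0_le_integral => //.
  + by move=> v _; rewrite lee_fin.
  + exact/measurable_EFinP.
  + by apply: emeasurable_funD => //; exact/measurable_EFinP.
  + by move=> v _; rewrite -EFinD lee_fin.
- by move=> v _; rewrite lee_fin.
- exact/measurable_EFinP.
Qed.

(** * Transfer risk of the empirical minimizer *)

Unset Implicit Arguments.
Set Strict Implicit.

(** The right-hand side is deterministic, so [eps] may be chosen to minimize it; the event [E]
    depends on [eps] through the cover. In [TL (Ahat w)] the algorithm is frozen at [w] and the
    expectation runs over the target data only. *)
Theorem theorem6
  (R : realType)
  (dX dY : measure_display) (X : measurableType dX) (Y : measurableType dY)
  (k n T : nat) (L B delta eps : R)
  (loss : Y -> 'rV[R]_k -> R)
  (A : set (algo R X Y k))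
  (* task space, task distribution, and per-task data distributions *)
  (dTh : measure_display) (Theta : measurableType dTh)
  (Dtask : probability Theta R) (D : R.-pker Theta ~> (X * Y)%type)
  (* underlying probability space and the random source / target data *)
  (dO : measure_display) (Omega : measurableType dO) (P : probability Omega R)
  (theta : 'I_T -> Omega -> Theta) (z : 'I_T -> 'I_n -> Omega -> (X * Y)%type)
  (thetaT : Omega -> Theta) (zT : 'I_n -> Omega -> (X * Y)%type)
  (Ahat : Omega -> algo R X Y k) :
  (0 < T)%N -> 0 < delta -> 0 <= L -> 0 <= eps ->
  (* loss is L-Lipschitz in its second argument and takes values in [0,B] *)
  (forall y u v, `|loss y u - loss y v| <= L * l2norm (u - v)) ->
  (forall y u, 0 <= loss y u <= B) ->
  (* measurability of the empirical loss of every algorithm in the class *)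
  (forall a, A a -> seq_measurable (emp_loss n loss a)) ->
  (forall t, measurable_fun setT (theta t)) ->
  (forall t i, measurable_fun setT (z t i)) ->
  measurable_fun setT thetaT -> (forall i, measurable_fun setT (zT i)) ->
  (* the T source tasks are independent, theta_t ~ Dtask, and given theta_t
     the sequence S_t = (z t i)_i is i.i.d. from D theta_t *)
  (forall (At : 'I_T -> set Theta) (Bt : 'I_T -> 'I_n -> set (X * Y)%type),
     (forall t, measurable (At t)) -> (forall t i, measurable (Bt t i)) ->
     P (\bigcap_(t in [set: 'I_T])
          (theta t @^-1` At t `&`
           \bigcap_(i in [set: 'I_n]) (z t i @^-1` Bt t i)))
     = (\prod_(t < T) \int[Dtask]_(th in At t)
           \prod_(i < n) D th (Bt t i))%E) ->
  (* the target task T ~ Dtask and its sequence S_T ~ D_T^n *)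
  (forall (A0 : set Theta) (B0 : 'I_n -> set (X * Y)%type),
     measurable A0 -> (forall i, measurable (B0 i)) ->
     P (thetaT @^-1` A0 `&` \bigcap_(i in [set: 'I_n]) (zT i @^-1` B0 i))
     = (\int[Dtask]_(th in A0) \prod_(i < n) D th (B0 i))%E) ->
  (* Ahat is the ICL-ERM over the source tasks *)
  (forall w, A (Ahat w)) ->
  (forall w a, A a ->
     T%:R^-1 * \sum_(t < T) emp_loss n loss (Ahat w) (fun i => z t i w)
     <= T%:R^-1 * \sum_(t < T) emp_loss n loss a (fun i => z t i w)) ->
  (* the covering number at scale eps is finite *)
  (cover_num n A eps < +oo)%E ->
  let TL := fun a : algo R X Y k =>
      fine (\int[P]_w (emp_loss n loss a (fun i => zT i w))%:E) in
  let N := fine (cover_num n A eps) in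
  exists E : set Omega, measurable E /\ ((1 - 2 * delta)%:E <= P E)%E /\
    forall w, E w ->
      TL (Ahat w) - inf [set TL a | a in A]
      <= 4 * L * eps + B * Num.sqrt (2 * ln (N / delta) / T%:R).
Proof.
move=> T0 delta0 L0 eps0 lossL lossB mloss mtheta mz mthetaT mzT source target
  AhatA erm Nfin TL N.
have B0 : 0 <= B by have /andP[] := lossB point 0; exact: le_trans.
(* For [delta] at least 1/2 the required probability is at most 0 and the empty event suffices.
   Otherwise [N / delta] is at least 1 and its logarithm is nonnegative. *)
have [dlarge|dsmall] := leP 2^-1 delta.
  exists set0; split; first exact: measurable0.
  split; last by [].
  by rewrite measure0 lee_fin; lra.
have [m [C [CA Ccov]] Nm] := cover_num_attained Nfin.
have NE : N = m%:R by rewrite /N Nm.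
(* Some algorithm of the class exists, namely [Ahat w0], so the cover has at least one center. *)
have w0 : Omega := point.
have [j0 _] := Ccov _ (AhatA w0).
have m0 : (0 < m)%N by apply: leq_trans (ltn_ord j0).
have m0R : 0 < m%:R :> R by rewrite ltr0n.
have T0R : 0 < T%:R :> R by rewrite ltr0n.
pose V := seq_space (X * Y)%type n.
pose S (t : 'I_T) (w : Omega) : V := fun i => z t i w.
pose S' (w : Omega) : V := fun i => zT i w.
have mS t : measurable_fun setT (S t) by exact: measurable_seq_space.
have mS' : measurable_fun setT S' by exact: measurable_seq_space.
pose S'm : {mfun Omega >-> V} :=
  HB.pack S' (isMeasurableFun.Build _ _ _ _ _ mS').
(* The law of the target sequence, with the task averaged out. Taking [setT] for the task events
   shows that it is also the law of each source sequence. *)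
pose Q : probability V R := distribution P S'm.
have indep (F : 'I_T -> set V) : (forall t, rectangles (F t)) ->
    P (\bigcap_(t in [set: 'I_T]) (S t @^-1` F t)) = (\prod_(t < T) Q (F t))%E.
  move=> rF; have rF' t : exists Bt : 'I_n -> set (X * Y)%type,
      (forall i, measurable (Bt i)) /\
      F t = \bigcap_(i in [set: 'I_n]) [set s : V | Bt i (s i)].
    by have [Bt mBt FE] := rF t; exists Bt.
  have [Bt BtP] := choice rF'.
  transitivity (P (\bigcap_(t in [set: 'I_T]) (theta t @^-1` setT `&`
      \bigcap_(i in [set: 'I_n]) (z t i @^-1` Bt t i)))).
    congr (P _); apply: eq_bigcapr => t _.
    by rewrite preimage_setT setTI (proj2 (BtP t)).
  rewrite source//; last by move=> t i; exact: (proj1 (BtP t)).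
  apply: eq_bigr => t _; rewrite -target//; last exact: (proj1 (BtP t)).
  by rewrite preimage_setT setTI (proj2 (BtP t)).
have mg a : A a -> measurable_fun [set: V] (emp_loss n loss a : V -> R).
  by move=> Aa; apply: seq_measurable_fun; exact: mloss.
have gB a (v : V) : 0 <= emp_loss n loss a v <= B by exact: emp_loss_bounds.
have TLE a : A a -> TL a = fine (\int[Q]_v (emp_loss n loss a v)%:E).
  move=> Aa; rewrite /TL /Q ge0_integral_distribution//.
    by apply/measurable_EFinP; exact: mg.
  by move=> v; rewrite lee_fin; have /andP[] := gB a v.
pose avg (a : algo R X Y k) w :=
  T%:R^-1 * \sum_(t < T) emp_loss n loss a (S t w).
(* Solves [2 * T * s^2 / B^2 = ln (N / delta)] when [B] is positive, so each center fails with
   probability at most [2 * delta / N]. *)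
pose s := B * Num.sqrt (2 * ln (N / delta) / T%:R) / 2.
have s0 : 0 <= s by rewrite divr_ge0// mulr_ge0// sqrtr_ge0.
pose bad j := [set w | s < `|avg (C j) w - TL (C j)|].
have mavg a : A a -> measurable_fun setT (avg a).
  by move=> Aa; apply: (measurable_avg mS); exact: mg.
have mbad j : measurable (bad j).
  rewrite -[bad j]setTI; apply: measurable_fun_ltr => //.
  by apply: measurableT_comp => //; apply: measurable_funB => //; exact: mavg.
have lnN0 : 0 <= ln (m%:R / delta).
  rewrite ln_ge0// ler_pdivlMr// mul1r (le_trans (ltW dsmall))//.
  by rewrite (@le_trans _ _ 1)// ?ler1n// invf_le1 ?ler1n.
have Pbad j : (P (bad j) <= (2 * (delta / m%:R))%:E)%E.
  (* Hoeffding's inequality is available for positive [B]; for [B = 0] all losses vanish and no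
     deviation occurs. *)
  have [B00|Bn0] := eqVneq B 0.
    rewrite (_ : bad j = set0) ?measure0 ?lee_fin ?mulr_ge0 ?divr_ge0//.
      exact: ltW.
    apply/seteqP; split => // w; rewrite /bad /= ltNge => /negP; apply.
    have emp0 v : emp_loss n loss (C j) v = 0.
      have /andP[ge0 le0] := gB (C j) v.
      by apply/eqP; rewrite eq_le ge0 (le_trans le0)// B00.
    rewrite /avg big1 ?mulr0; last by move=> t _; exact: emp0.
    rewrite TLE// (_ : fine _ = 0) ?subrr ?normr0//.
    by rewrite integral0_eq// => v _; rewrite emp0.
  have Bpos : 0 < B by rewrite lt_neqAle eq_sym Bn0.
  have := hoeffding_two_sided (measurable_rectangles _ n)
    (@rectangles_setI _ _ n) (rectangles_setT _ n) mS indep T0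
    (mg _ (CA j)) (gB (C j)) Bpos s0.
  rewrite -TLE//; move/le_trans; apply; rewrite lee_fin ler_wpM2l//.
  rewrite (_ : 2 * T%:R * s ^+ 2 / B ^+ 2 = ln (m%:R / delta)).
    by rewrite expRN lnK ?posrE ?divr_gt0// invf_div.
  rewrite /s expr_div_n exprMn sqr_sqrtr; last first.
    by rewrite divr_ge0// mulr_ge0// NE; exact: lnN0.
  by rewrite NE; field; rewrite Bn0 gt_eqF.
(* From here on the argument is deterministic: [w] is fixed and every center deviates by at most
   [s]. *)
have main w : (forall j, ~ bad j w) ->
    TL (Ahat w) - inf [set TL a | a in A] <= 2 * s + 4 * (L * eps).
  move=> good.
  have TLle a c : A a -> A c -> (alg_dist n a c <= eps%:E)%E ->
      TL a <= TL c + L * eps /\ TL c <= TL a + L * eps.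
    move=> Aa Ac ac; rewrite !TLE//.
    have close v := emp_loss_close L0 lossL v ac.
    split; apply: (mean_le_shift Q _ _ (gB _) (gB _)); try exact: mg.
    - by rewrite mulr_ge0.
    - by move=> v; have := close v; rewrite ler_norml => /andP[? ?]; lra.
    - by rewrite mulr_ge0.
    - by move=> v; have := close v; rewrite ler_norml => /andP[? ?]; lra.
  have avgle a c : (alg_dist n a c <= eps%:E)%E ->
      avg a w <= avg c w + L * eps /\ avg c w <= avg a w + L * eps.
    move=> ac.
    have close v := emp_loss_close L0 lossL v ac.
    (* Written as an average over the tasks, the shift can be compared term by term. *)
    have LE : L * eps = T%:R^-1 * \sum_(t < T) L * eps.
      by rewrite sumr_const card_ord -(mulr_natl (L * eps)) mulKf// gt_eqF.
    rewrite LE /avg -!mulrDr -!big_split/=.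
    by split; rewrite ler_pM2l ?invr_gt0//; apply: ler_sum => t _;
      have := close (S t w); rewrite ler_norml => /andP[? ?]; lra.
  have dev j : `|avg (C j) w - TL (C j)| <= s by rewrite leNgt; apply/negP/good.
  have [j1 cov1] := Ccov _ (AhatA w).
  rewrite lerBlDl -lerBlDr; apply: lb_le_inf.
    by exists (TL (Ahat w)), (Ahat w).
  move=> _ [a Aa <-].
  have [j2 cov2] := Ccov _ Aa.
  (* The chain runs from [TL (Ahat w)] to [TL] at its center, [avg] there, [avg (Ahat w)], [avg a],
     [avg] at the center of [a], [TL] there, and [TL a]. Four steps cost [L * eps], two cost [s],
     and minimality costs nothing. *)
  have [h1 _] := TLle _ _ (AhatA w) (CA j1) cov1.
  have [_ h2] := avgle _ _ cov1.
  have h3 : avg (Ahat w) w <= avg a w by exact: erm.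
  have [h4 _] := avgle _ _ cov2.
  have [_ h5] := TLle _ _ Aa (CA j2) cov2.
  have := dev j1; have := dev j2; rewrite !ler_norml => /andP[? ?] /andP[? ?].
  by lra.
(* The event involves the finitely many centers only, hence is measurable; the failure probabilities
   add up to [2 * delta]. *)
exists (~` \big[setU/set0]_(j < m) bad j); split.
  by apply: measurableC; exact: bigsetU_measurable.
split.
  rewrite probability_setC; last exact: bigsetU_measurable.
  rewrite EFinB leeB//; apply: le_trans (prob_bigsetU_le mbad Pbad) _.
  by rewrite lee_fin mulrCA (mulrCA _ delta) divff ?mulr1// gt_eqF.
move=> w Ew; apply: le_trans (main w _) _.
  by move=> j badj; apply: Ew; rewrite (bigD1 j)//=; left.
by rewrite le_eqVlt; apply/orP; left; apply/eqP; rewrite /s; field.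
Qed.
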